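(* Let $A$ be a finitely generated compact abelian Lie group. For any object $F$ of the bicategory $2\mathrm{Rep}(BA)$, corresponding to data $(\mathcal{D},\mathcal{M},F^2,F^0,\alpha)$, there is a unique object $G$ of the form $(\mathcal{D},\mathcal{D},l_{\mathcal{D}},\mathrm{id}_{\mathcal{D}},\beta)$ internally equivalent to $F$.
   Context: $k$ is a field of characteristic zero (typically $\mathbb{R}$ or $\mathbb{C}$). $\mathsf{s2Vect}_k$ is the bicategory of finite-dimensional super algebras over $k$ ($\mathbb{Z}/2$-graded, unital, associative); 1-morphisms $\mathcal{A}\to\mathcal{B}$ are $\mathbb{Z}/2$-graded finitely generated $\mathcal{B}$-$\mathcal{A}$-bimodules composed by relative tensor product; 2-morphisms are parity-preserving intertwiners. $l,r$ denote its left and right unitors. $BA$ is the strict 2-group with one object $*$, morphisms the elements of $A$, and multiplication and composition both given by addition in $A$. $BBA$ is its delooping: one object $*$, one 1-morphism $\mathrm{id}_*$, and 2-morphisms $A$. $2\mathrm{Rep}(BA)$ is the bicategory of pseudofunctors $BBA\to\mathsf{s2Vect}_k$, strong transformations and modifications (all assignments smooth, by the paper's convention). An object of $2\mathrm{Rep}(BA)$ is given by data $(\mathcal{D},\mathcal{M},F^2,F^0,\alpha)$: a super algebra $\mathcal{D}=F( * )$; an invertible $\mathcal{D}$-$\mathcal{D}$-bimodule $\mathcal{M}=F(\mathrm{id}_* )$; a group homomorphism $\alpha:A\to\mathrm{Aut}_{\mathcal{D}\text{-}\mathcal{D}}(\mathcal{M})$ into the group of invertible $\mathcal{D}$-$\mathcal{D}$-intertwiners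 $\mathcal{M}\to\mathcal{M}$; and the compositor $F^2:\mathcal{M}\otimes_{\mathcal{D}}\mathcal{M}\to\mathcal{M}$ and unitor $F^0:\mathcal{D}\to\mathcal{M}$, which are 2-isomorphisms satisfying the pseudofunctor coherence conditions. In $(\mathcal{D},\mathcal{D},l_{\mathcal{D}},\mathrm{id}_{\mathcal{D}},\beta)$ the bimodule is $\mathcal{D}$ itself, the compositor is the left unitor $l_{\mathcal{D}}:\mathcal{D}\otimes_{\mathcal{D}}\mathcal{D}\to\mathcal{D}$, the unitor is the identity, and $\beta:A\to\mathrm{Aut}_{\mathcal{D}\text{-}\mathcal{D}}(\mathcal{D})$ is a group homomorphism. Two objects of a bicategory are internally equivalent if there is an invertible (up to 2-isomorphism) 1-morphism between them.
   Formalization: Literal uniqueness of G fails (A=Z/2, D=k×k, β=(1,sgn), β'=(sgn,1)); instead G is shown unique up to internal equivalence, and β is strictly unique among those for which some equivalence F→G has the identity bimodule D as its 1-morphism. *)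

(* Defs.v *)
From HB Require Import structures.
From mathcomp Require Import all_boot all_order all_algebra.
From mathcomp Require Import all_classical all_reals all_analysis.
From mathcomp Require Import complex.

Set Implicit Arguments.
Unset Strict Implicit.
Unset Printing Implicit Defensive.

Import Order.TTheory GRing.Theory Num.Theory numFieldNormedType.Exports.
Import VectorInternalTheory.

Local Open Scope ring_scope.

Declare Scope bicat_scope.
Delimit Scope bicat_scope with bicat.

Reserved Notation "g \o1 f" (at level 40, left associativity).
Reserved Notation "b \oh a" (at level 40, left associativity).
Reserved Notation "b \ov a" (at level 42, right associativity).

(** * Bicategories, pseudofunctors and strong transformations

    Composition is written in the order of functions. The conventions for the
    coherence 2-cells are those of Johnson and Yau, 2-Dimensional Categories. *)

Record bicategory := Bicategory {
  ob :> Type;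
  hom1 : ob -> ob -> Type;
  hom2 : forall a b, hom1 a b -> hom1 a b -> Type;
  id1 : forall a, hom1 a a;
  comp1 : forall a b c, hom1 b c -> hom1 a b -> hom1 a c;
  id2 : forall a b (f : hom1 a b), hom2 f f;
  vcomp : forall a b (f g h : hom1 a b), hom2 g h -> hom2 f g -> hom2 f h;
  hcomp : forall a b c (g g' : hom1 b c) (f f' : hom1 a b),
    hom2 g g' -> hom2 f f' -> hom2 (comp1 g f) (comp1 g' f');
  asso : forall a b c d (h : hom1 c d) (g : hom1 b c) (f : hom1 a b),
    hom2 (comp1 (comp1 h g) f) (comp1 h (comp1 g f));
  assoV : forall a b c d (h : hom1 c d) (g : hom1 b c) (f : hom1 a b),
    hom2 (comp1 h (comp1 g f)) (comp1 (comp1 h g) f);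
  lunit : forall a b (f : hom1 a b), hom2 (comp1 (id1 b) f) f;
  lunitV : forall a b (f : hom1 a b), hom2 f (comp1 (id1 b) f);
  runit : forall a b (f : hom1 a b), hom2 (comp1 f (id1 a)) f;
  runitV : forall a b (f : hom1 a b), hom2 f (comp1 f (id1 a));
  vcompA : forall a b (f g h i : hom1 a b)
      (z : hom2 h i) (y : hom2 g h) (x : hom2 f g),
    vcomp z (vcomp y x) = vcomp (vcomp z y) x;
  vcomp1l : forall a b (f g : hom1 a b) (x : hom2 f g), vcomp (id2 g) x = x;
  vcomp1r : forall a b (f g : hom1 a b) (x : hom2 f g), vcomp x (id2 f) = x;
  hcomp1 : forall a b c (g : hom1 b c) (f : hom1 a b),
    hcomp (id2 g) (id2 f) = id2 (comp1 g f);
  interchange : forall a b c (g g' g'' : hom1 b c) (f f' f'' : hom1 a b)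
      (y' : hom2 g' g'') (y : hom2 g g') (x' : hom2 f' f'') (x : hom2 f f'),
    hcomp (vcomp y' y) (vcomp x' x) = vcomp (hcomp y' x') (hcomp y x);
  asso_nat : forall a b c d (h h' : hom1 c d) (g g' : hom1 b c)
      (f f' : hom1 a b) (z : hom2 h h') (y : hom2 g g') (x : hom2 f f'),
    vcomp (asso h' g' f') (hcomp (hcomp z y) x)
    = vcomp (hcomp z (hcomp y x)) (asso h g f);
  lunit_nat : forall a b (f f' : hom1 a b) (x : hom2 f f'),
    vcomp (lunit f') (hcomp (id2 (id1 b)) x) = vcomp x (lunit f);
  runit_nat : forall a b (f f' : hom1 a b) (x : hom2 f f'),
    vcomp (runit f') (hcomp x (id2 (id1 a))) = vcomp x (runit f);
  assoK : forall a b c d (h : hom1 c d) (g : hom1 b c) (f : hom1 a b),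
    vcomp (assoV h g f) (asso h g f) = id2 _;
  assoVK : forall a b c d (h : hom1 c d) (g : hom1 b c) (f : hom1 a b),
    vcomp (asso h g f) (assoV h g f) = id2 _;
  lunitK : forall a b (f : hom1 a b), vcomp (lunitV f) (lunit f) = id2 _;
  lunitVK : forall a b (f : hom1 a b), vcomp (lunit f) (lunitV f) = id2 _;
  runitK : forall a b (f : hom1 a b), vcomp (runitV f) (runit f) = id2 _;
  runitVK : forall a b (f : hom1 a b), vcomp (runit f) (runitV f) = id2 _;
  triangle : forall a b c (g : hom1 b c) (f : hom1 a b),
    vcomp (hcomp (id2 g) (lunit f)) (asso g (id1 b) f)
    = hcomp (runit g) (id2 f);
  pentagon : forall a b c d e (i : hom1 d e) (h : hom1 c d) (g : hom1 b c)
      (f : hom1 a b),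
    vcomp (asso i h (comp1 g f)) (asso (comp1 i h) g f)
    = vcomp (hcomp (id2 i) (asso h g f))
        (vcomp (asso i (comp1 h g) f) (hcomp (asso i h g) (id2 f)))
}.

Arguments id1 {_} _.
Arguments id2 {_ _ _} _.

Notation "g \o1 f" := (comp1 g f) : bicat_scope.
Notation "b \oh a" := (hcomp b a) : bicat_scope.
Notation "b \ov a" := (vcomp b a) : bicat_scope.

Local Open Scope bicat_scope.

Definition iso2 (C : bicategory) (a b : C) (f g : hom1 a b) (x : hom2 f g) :=
  exists y : hom2 g f, y \ov x = id2 f /\ x \ov y = id2 g.

Record pseudofunctor (B C : bicategory) := Pseudofunctor {
  pf_ob :> B -> C;
  pf_1 : forall a b, hom1 a b -> hom1 (pf_ob a) (pf_ob b);
  pf_2 : forall a b (f g : hom1 a b), hom2 f g -> hom2 (pf_1 f) (pf_1 g);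
  pf_F2 : forall a b c (g : hom1 b c) (f : hom1 a b),
    hom2 (pf_1 g \o1 pf_1 f) (pf_1 (g \o1 f));
  pf_F0 : forall a, hom2 (id1 (pf_ob a)) (pf_1 (id1 a));
  pf_id2 : forall a b (f : hom1 a b), pf_2 (id2 f) = id2 (pf_1 f);
  pf_vcomp : forall a b (f g h : hom1 a b) (y : hom2 g h) (x : hom2 f g),
    pf_2 (y \ov x) = pf_2 y \ov pf_2 x;
  pf_F2_iso : forall a b c (g : hom1 b c) (f : hom1 a b), iso2 (pf_F2 g f);
  pf_F0_iso : forall a, iso2 (pf_F0 a);
  pf_F2_nat : forall a b c (g g' : hom1 b c) (f f' : hom1 a b)
      (y : hom2 g g') (x : hom2 f f'),
    pf_2 (y \oh x) \ov pf_F2 g f = pf_F2 g' f' \ov (pf_2 y \oh pf_2 x);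
  pf_asso : forall a b c d (h : hom1 c d) (g : hom1 b c) (f : hom1 a b),
    pf_F2 h (g \o1 f) \ov (id2 (pf_1 h) \oh pf_F2 g f) \ov
      asso (pf_1 h) (pf_1 g) (pf_1 f)
    = pf_2 (asso h g f) \ov pf_F2 (h \o1 g) f \ov
      (pf_F2 h g \oh id2 (pf_1 f));
  pf_lunit : forall a b (f : hom1 a b),
    lunit (pf_1 f)
    = pf_2 (lunit f) \ov pf_F2 (id1 b) f \ov (pf_F0 b \oh id2 (pf_1 f));
  pf_runit : forall a b (f : hom1 a b),
    runit (pf_1 f)
    = pf_2 (runit f) \ov pf_F2 f (id1 a) \ov (id2 (pf_1 f) \oh pf_F0 a)
}.

Arguments pf_1 {B C} p {a b} f.
Arguments pf_2 {B C} p {a b f g} x.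
Arguments pf_F2 {B C} p {a b c} g f.
Arguments pf_F0 {B C} p a.

Section Transformations.
Variables B C : bicategory.
Implicit Types F G H : pseudofunctor B C.

Record transformation F G := Transformation {
  tr_1 :> forall a : B, hom1 (F a) (G a);
  tr_2 : forall (a b : B) (f : hom1 a b),
    hom2 (pf_1 G f \o1 tr_1 a) (tr_1 b \o1 pf_1 F f)
}.

Definition strong F G (s : transformation F G) : Prop :=
  [/\ forall a b (f : hom1 a b), iso2 (tr_2 s f),
      forall a b (f g : hom1 a b) (x : hom2 f g),
        tr_2 s g \ov (pf_2 G x \oh id2 (s a))
        = (id2 (s b) \oh pf_2 F x) \ov tr_2 s f,
      forall a,
        tr_2 s (id1 a) \ov (pf_F0 G a \oh id2 (s a))
        = (id2 (s a) \oh pf_F0 F a) \ov runitV (s a) \ov lunit (s a)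
    & forall a b c (g : hom1 b c) (f : hom1 a b),
        tr_2 s (g \o1 f) \ov (pf_F2 G g f \oh id2 (s a))
        = (id2 (s c) \oh pf_F2 F g f) \ov asso (s c) (pf_1 F g) (pf_1 F f) \ov
          (tr_2 s g \oh id2 (pf_1 F f)) \ov
          assoV (pf_1 G g) (s b) (pf_1 F f) \ov
          (id2 (pf_1 G g) \oh tr_2 s f) \ov
          asso (pf_1 G g) (pf_1 G f) (s a)].

Definition tr_id F : transformation F F :=
  @Transformation F F (fun a => id1 (F a))
    (fun a b f => lunitV (pf_1 F f) \ov runit (pf_1 F f)).

Definition tr_comp F G H (t : transformation G H) (s : transformation F G) :
    transformation F H :=
  @Transformation F H (fun a => t a \o1 s a)
    (fun a b f =>
       assoV (t b) (s b) (pf_1 F f) \ov (id2 (t b) \oh tr_2 s f) \ov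
       asso (t b) (pf_1 G f) (s a) \ov (tr_2 t f \oh id2 (s a)) \ov
       assoV (pf_1 H f) (t a) (s a)).

Definition modification F G (s t : transformation F G)
    (m : forall a, hom2 (s a) (t a)) : Prop :=
  forall a b (f : hom1 a b),
    (m b \oh id2 (pf_1 F f)) \ov tr_2 s f
    = tr_2 t f \ov (id2 (pf_1 G f) \oh m a).

Definition iso_transformation F G (s t : transformation F G) : Prop :=
  exists m : forall a, hom2 (s a) (t a),
    modification m /\ forall a, iso2 (m a).

Definition equivalence F G (s : transformation F G) : Prop :=
  strong s /\
  exists t : transformation G F,
    [/\ strong t, iso_transformation (tr_comp t s) (tr_id F)
      & iso_transformation (tr_comp s t) (tr_id G)].

Definition internally_equivalent F G : Prop :=
  exists s : transformation F G, equivalence s.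

End Transformations.

(** * The bicategory [BBA] *)

Section BBA.
Variable A : zmodType.

Definition BBA : bicategory.
Proof.
refine (@Bicategory unit (fun _ _ => unit) (fun _ _ _ _ => A : Type)
  (fun _ => tt) (fun _ _ _ _ _ => tt) (fun _ _ _ => 0)
  (fun _ _ _ _ _ y x => y + x) (fun _ _ _ _ _ _ _ y x => y + x)
  (fun _ _ _ _ _ _ _ => 0) (fun _ _ _ _ _ _ _ => 0)
  (fun _ _ _ => 0) (fun _ _ _ => 0) (fun _ _ _ => 0) (fun _ _ _ => 0)
  _ _ _ _ _ _ _ _ _ _ _ _ _ _ _ _) => *; rewrite ?addr0 ?add0r //.
- by rewrite addrA.
- by rewrite addrACA.
- by rewrite addrA.
Defined.

End BBA.

(** * Super vector spaces, super algebras and graded bimodules *)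

Section Super.
Variable k : fieldType.

Record svect := SVect {
  sv_vect :> vectType k;
  par : bool -> {vspace sv_vect};
  par_direct : (par false :&: par true)%VS = 0%VS;
  par_full : (par false + par true)%VS = fullv
}.

(* The zero algebra is allowed, which excludes [falgType]. *)
Record salg := SAlg {
  sa_svect :> svect;
  smul : sa_svect -> sa_svect -> sa_svect;
  sone : sa_svect;
  smul_linl : forall y, linear (smul^~ y);
  smul_linr : forall x, linear (smul x);
  smulA : associative smul;
  smul1l : left_id sone smul;
  smul1r : right_id sone smul;
  smul_par : forall i j x y,
    x \in par sa_svect i -> y \in par sa_svect j ->
    smul x y \in par sa_svect (i (+) j);
  sone_par : sone \in par sa_svect false
}.

(* As [A] and [B] are finite dimensional, finitely generated bimodules are the
   finite-dimensional ones. The right action is written [ract m a]. *)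
Record bimod (B A : salg) := BiMod {
  bm_svect :> svect;
  lact : B -> bm_svect -> bm_svect;
  ract : bm_svect -> A -> bm_svect;
  lact_linl : forall m, linear (lact^~ m);
  lact_linr : forall b, linear (lact b);
  ract_linl : forall a, linear (ract^~ a);
  ract_linr : forall m, linear (ract m);
  lactM : forall b b' m, lact (smul b b') m = lact b (lact b' m);
  ractM : forall m a a', ract m (smul a a') = ract (ract m a) a';
  lact1 : forall m, lact (sone B) m = m;
  ract1 : forall m, ract m (sone A) = m;
  lractA : forall b m a, ract (lact b m) a = lact b (ract m a);
  lact_par : forall i j b m,
    b \in par B i -> m \in par bm_svect j -> lact b m \in par bm_svect (i (+) j);
  ract_par : forall i j m a,
    m \in par bm_svect i -> a \in par A j -> ract m a \in par bm_svect (i (+) j)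
}.

Record bimap (B A : salg) (M N : bimod B A) := BiMap {
  bm_fun :> 'Hom(M, N);
  bm_lact : forall b m, bm_fun (lact b m) = lact b (bm_fun m);
  bm_ract : forall m a, bm_fun (ract m a) = ract (bm_fun m) a;
  bm_par : forall i m, m \in par M i -> bm_fun m \in par N i
}.

Lemma bimap_eq (B A : salg) (M N : bimod B A) (f g : bimap M N) :
  (forall x, f x = g x) -> f = g.
Proof.
case: f g => [f f1 f2 f3] [g g1 g2 g3] /= fg.
have e : f = g by apply/lfunP.
case: _ / e g1 g2 g3 {fg} => g1 g2 g3.
by rewrite (Prop_irrelevance f1 g1) (Prop_irrelevance f2 g2)
  (Prop_irrelevance f3 g3).
Qed.

Lemma linfun_linE (U V : vectType k) (f : U -> V) :
  linear f -> linfun f =1 f.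
Proof.
move=> lf x.
pose m := GRing.isLinear.Build k U V *:%R f lf.
pose F : {linear U -> V} := HB.pack f m.
exact: (lfunE F).
Qed.

Lemma linear_lfun (U V : vectType k) (f : 'Hom(U, V)) : linear f.
Proof. by move=> a x y; rewrite linearP. Qed.

Lemma lin_comp (U V W : lmodType k) (f : V -> W) (g : U -> V) :
  linear f -> linear g -> linear (fun x => f (g x)).
Proof. by move=> lf lg a x y; rewrite lg lf. Qed.

Lemma lin_id (U : lmodType k) : linear (fun x : U => x).
Proof. by []. Qed.

Lemma lin0 (U V : lmodType k) (f : U -> V) : linear f -> f 0 = 0.
Proof. by move=> lf; have := lf (-1) 0 0; rewrite scaler0 addr0 scaleN1r addNr. Qed.

Lemma linD (U V : lmodType k) (f : U -> V) x y :
  linear f -> f (x + y) = f x + f y.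
Proof. by move=> lf; have := lf 1 x y; rewrite !scale1r. Qed.

Lemma linZ (U V : lmodType k) (f : U -> V) a x : linear f -> f (a *: x) = a *: f x.
Proof. by move=> lf; have := lf a x 0; rewrite (lin0 lf) !addr0. Qed.

Lemma linB (U V : lmodType k) (f : U -> V) x y :
  linear f -> f (x - y) = f x - f y.
Proof.
by move=> lf; rewrite (linD _ _ lf) -[- y]scaleN1r (linZ _ _ lf) scaleN1r.
Qed.

Lemma lin_sum (U V : lmodType k) (f : U -> V) I (r : seq I) (P : pred I) E :
  linear f -> f (\sum_(i <- r | P i) E i) = \sum_(i <- r | P i) f (E i).
Proof.
move=> lf; apply: (big_morph f) => [x y|]; first exact: linD.
exact: lin0.
Qed.

(** ** Homogeneous components *)

Section Parity.
Variable V : svect.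

Lemma par_cap c : (par V c :&: par V (~~ c))%VS = 0%VS.
Proof. by case: c; [rewrite capvC|]; exact: par_direct. Qed.

Definition pproj (c : bool) : 'End(V) := daddv_pi (par V c) (par V (~~ c)).

Lemma pproj_par c x : pproj c x \in par V c.
Proof. exact: memv_pi. Qed.

Lemma pproj_sum x : x = pproj false x + pproj true x.
Proof.
by rewrite /pproj /= daddv_pi_add ?(par_cap false) ?par_full ?memvf.
Qed.

Lemma pproj_id c x : x \in par V c -> pproj c x = x.
Proof. exact: daddv_pi_id (par_cap c). Qed.

Lemma pprojE c i x : x \in par V i -> pproj c x = if i == c then x else 0.
Proof.
move=> xi; case: eqP => [<-|/eqP ic]; first exact: pproj_id.
have sx := pproj_sum x; move: (pproj_id xi) => px.
have {}ic : c = ~~ i by case: c i ic {xi px} => [] [].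
rewrite {}ic; apply: (@addrI _ x); rewrite addr0 -{1}px [RHS]sx.
by case: i {xi px sx} => //=; rewrite addrC.
Qed.

Lemma homog_ext (W : lmodType k) (f g : V -> W) :
  linear f -> linear g -> (forall i x, x \in par V i -> f x = g x) -> f =1 g.
Proof.
move=> lf lg e x; rewrite (pproj_sum x) (linD _ _ lf) (linD _ _ lg).
by rewrite (e false) ?(e true) ?pproj_par.
Qed.

End Parity.

Arguments pproj {V} c.

(** ** Tensor product over [k], modelled by matrices in coordinates *)

Section Tensor.
Variables U V : vectType k.

Definition tens (u : U) (v : V) : 'M[k]_(dim U, dim V) := (v2r u)^T *m v2r v.

Definition bvec (W : vectType k) (i : 'I_(dim W)) : W := r2v (delta_mx 0 i).

Lemma bvec_sum (W : vectType k) (w : W) :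
  w = \sum_i v2r w 0 i *: bvec i.
Proof.
rewrite -[LHS]v2rK {1}(row_sum_delta (v2r w)) linear_sum.
by apply: eq_bigr => i _; rewrite linearZ.
Qed.

Lemma tens_linl v : linear (tens^~ v).
Proof. by move=> a x y; rewrite /tens linearP linearP mulmxDl scalemxAl. Qed.

Lemma tens_linr u : linear (tens u).
Proof. by move=> a x y; rewrite /tens linearP mulmxDr scalemxAr. Qed.

Lemma tens_bvec i j : tens (bvec i) (bvec j) = delta_mx i j.
Proof. by rewrite /tens !r2vK trmx_delta mul_delta_mx. Qed.

Lemma tens_coord u v i j : tens u v i j = v2r u 0 i * v2r v 0 j.
Proof. by rewrite /tens !mxE big_ord1 !mxE. Qed.

Variable W : lmodType k.

Definition klift (f : U -> V -> W) (X : 'M[k]_(dim U, dim V)) : W :=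
  \sum_i \sum_j X i j *: f (bvec i) (bvec j).

Lemma klift_lin f : linear (klift f).
Proof.
move=> a X Y; rewrite /klift scaler_sumr -big_split; apply: eq_bigr => i _ /=.
rewrite scaler_sumr -big_split; apply: eq_bigr => j _ /=.
by rewrite !mxE scalerDl scalerA.
Qed.

Lemma kliftE f u v : (forall y, linear (f^~ y)) -> (forall x, linear (f x)) ->
  klift f (tens u v) = f u v.
Proof.
move=> fl fr; rewrite {2}(bvec_sum u) (lin_sum _ _ _ (fl v)).
apply: eq_bigr => i _; rewrite (linZ _ _ (fl v)).
rewrite {2}(bvec_sum v) (lin_sum _ _ _ (fr _)) scaler_sumr.
by apply: eq_bigr => j _; rewrite (linZ _ _ (fr _)) scalerA tens_coord.
Qed.

Lemma klift_ext (f g : 'M[k]_(dim U, dim V) -> W) :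
  linear f -> linear g -> (forall u v, f (tens u v) = g (tens u v)) -> f =1 g.
Proof.
move=> lf lg e X; rewrite (matrix_sum_delta X) (lin_sum _ _ _ lf) (lin_sum _ _ _ lg).
apply: eq_bigr => i _; rewrite (lin_sum _ _ _ lf) (lin_sum _ _ _ lg).
by apply: eq_bigr => j _; rewrite (linZ _ _ lf) (linZ _ _ lg) -tens_bvec e.
Qed.

End Tensor.

(** ** Quotient of a finite-dimensional vector space by a subspace, realised
    on the chosen complement [(U^C)%VS] *)

Section Quotient.
Variables (V : vectType k) (U : {vspace V}).

Definition quotv : vectType k := subvs_of (U^C)%VS.
Definition quot_pi (v : V) : quotv := vsproj (U^C)%VS (daddv_pi (U^C)%VS U v).

Lemma quot_pi_lin : linear quot_pi.
Proof. by move=> a x y; rewrite /quot_pi !linearP. Qed.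

Lemma quot_piK (x : quotv) : quot_pi (vsval x) = x.
Proof.
rewrite /quot_pi daddv_pi_id ?vsvalK ?subvsP //.
by rewrite capvC capv_compl.
Qed.

Lemma quot_pi_sub v : v - vsval (quot_pi v) \in U.
Proof.
rewrite /quot_pi vsprojK ?memv_pi //.
have v_in : v \in (U^C + U)%VS by rewrite addvC addv_complf memvf.
have cap0 : (U^C :&: U = 0)%VS by rewrite capvC capv_compl.
rewrite -{1}(daddv_pi_add cap0 v_in) addrAC subrr add0r.
exact: memv_pi.
Qed.

Lemma quot_pi_eq0 v : v \in U -> quot_pi v = 0.
Proof.
move=> vU; apply/eqP; rewrite -(inj_eq val_inj) /= -memv0.
rewrite -(capv_compl U) memv_cap subvsP andbT.
have := quot_pi_sub v; move=> h.
by rewrite -[X in X \in _](subKr v) memvB.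
Qed.

End Quotient.

(** ** Relative tensor product *)

Section RelTensor.
Variables (C B A : salg) (M : bimod C B) (N : bimod B A).

Definition balance : {vspace 'M[k]_(dim M, dim N)} :=
  <<[seq tens (ract z.1.1 z.1.2) z.2 - tens z.1.1 (lact z.1.2 z.2) | z <-
     [seq (y, n) | y <- [seq (m, b) | m <- vbasis {:M}, b <- vbasis {:B}],
                   n <- vbasis {:N}]]>>%VS.

Definition rtens : vectType k := quotv balance.
Definition rt (m : M) (n : N) : rtens := quot_pi balance (tens m n).

Lemma rt_linl n : linear (rt^~ n).
Proof. by move=> a x y; rewrite /rt tens_linl quot_pi_lin. Qed.

Lemma rt_linr m : linear (rt m).
Proof. by move=> a x y; rewrite /rt tens_linr quot_pi_lin. Qed.

Lemma balanceP m b n : tens (ract m b) n - tens m (lact b n) \in balance.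
Proof.
have lin_in (I : finType) (V V' : vectType k) (f : V -> V') (S : {vspace V'})
    (c : I -> k) (e : I -> V) :
  linear f -> (forall i, f (e i) \in S) -> f (\sum_i c i *: e i) \in S.
  move=> lf fe; rewrite (lin_sum _ _ _ lf); apply: memv_suml => i _.
  by rewrite (linZ _ _ lf) memvZ.
pose f (m' : M) (b' : B) (n' : N) := tens (ract m' b') n' - tens m' (lact b' n').
have f1 b' n' : linear (fun m' => f m' b' n').
  move=> a x y; rewrite /f ract_linl !tens_linl.
  by rewrite scalerBr opprD addrACA.
have f2 m' n' : linear (fun b' => f m' b' n').
  move=> a x y; rewrite /f ract_linr tens_linl lact_linl tens_linr.
  by rewrite scalerBr opprD addrACA.
have f3 m' b' : linear (fun n' => f m' b' n').
  move=> a x y; rewrite /f lact_linr !tens_linr.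
  by rewrite scalerBr opprD addrACA.
rewrite -/(f m b n) (coord_vbasis (memvf m)) (coord_vbasis (memvf b)).
rewrite (coord_vbasis (memvf n)).
apply: (lin_in _ _ _ (fun m' => f m' _ _)) => // i.
apply: (lin_in _ _ _ (fun b' => f _ b' _)) => // j.
apply: (lin_in _ _ _ (fun n' => f _ _ n')) => // l.
apply: memv_span; apply/mapP.
exists ((vbasis {:M})`_i, (vbasis {:B})`_j, (vbasis {:N})`_l) => //.
by rewrite !allpairs_f // mem_nth // size_tuple.
Qed.

Lemma rt_balanced m b n : rt (ract m b) n = rt m (lact b n).
Proof.
apply/eqP; rewrite -subr_eq0 /rt -(linB _ _ (quot_pi_lin _)).
by rewrite quot_pi_eq0 // balanceP.
Qed.

Lemma rt_ext (W : lmodType k) (f g : rtens -> W) :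
  linear f -> linear g -> (forall m n, f (rt m n) = g (rt m n)) -> f =1 g.
Proof.
move=> lf lg e x; rewrite -(quot_piK x).
move: (vsval x); apply: (@klift_ext _ _ _ (f \o quot_pi balance) (g \o quot_pi balance)).
- by move=> a y z /=; rewrite quot_pi_lin lf.
- by move=> a y z /=; rewrite quot_pi_lin lg.
- exact: e.
Qed.

(* The universal property of the relative tensor product is [rliftE]. *)
Definition rlift (W : lmodType k) (f : M -> N -> W) (x : rtens) : W :=
  klift f (vsval x).

Lemma rlift_lin (W : lmodType k) (f : M -> N -> W) : linear (rlift f).
Proof. by move=> a x y; rewrite /rlift linearP klift_lin. Qed.

Lemma rliftE (W : lmodType k) (f : M -> N -> W) m n :
  (forall y, linear (f^~ y)) -> (forall x, linear (f x)) ->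
  (forall x b y, f (ract x b) y = f x (lact b y)) ->
  rlift f (rt m n) = f m n.
Proof.
move=> fl fr fb; rewrite /rlift.
have kB v : v \in balance -> klift f v = 0.
  rewrite /balance; set X := map _ _ => vB.
  rewrite (coord_span (X := in_tuple X) vB) (lin_sum _ _ _ (klift_lin f)).
  rewrite big1 // => i _; rewrite (linZ _ _ (klift_lin f)).
  have : X`_i \in X by rewrite mem_nth.
  case/mapP => z _ ->.
  by rewrite (linB _ _ (klift_lin f)) !kliftE // fb subrr scaler0.
have := kB _ (quot_pi_sub balance (tens m n)).
rewrite (linB _ _ (klift_lin f)) kliftE // => /eqP; rewrite subr_eq0.
by move/eqP.
Qed.


Lemma rlift_fun_lin (U : lmodType k) (W : lmodType k) (f : U -> M -> N -> W) x :
  (forall m n, linear (fun u => f u m n)) -> linear (fun u => rlift (f u) x).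
Proof.
move=> lf a u v; rewrite /rlift /klift scaler_sumr -big_split.
apply: eq_bigr => i _ /=; rewrite scaler_sumr -big_split.
apply: eq_bigr => j _ /=; rewrite lf scalerDr !scalerA.
by rewrite [_ * a]mulrC.
Qed.

Lemma rt_mem (S : {vspace rtens}) :
  (forall m n, rt m n \in S) -> forall x, x \in S.
Proof.
move=> h x; rewrite -(quot_piK x) [vsval x]matrix_sum_delta.
rewrite (lin_sum _ _ _ (quot_pi_lin _)); apply: memv_suml => i _.
rewrite (lin_sum _ _ _ (quot_pi_lin _)); apply: memv_suml => j _.
by rewrite (linZ _ _ (quot_pi_lin _)) -tens_bvec memvZ // h.
Qed.

(** The grading: [m] of degree [i] and [n] of degree [j] give [rt m n] of
    degree [i + j] *)

Definition rpar (c : bool) : {vspace rtens} :=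
  (\sum_(i : bool) <<[seq rt m n | m <- vbasis (par M i),
                                   n <- vbasis (par N (i (+) c))]>>)%VS.

Lemma rpar_sub c (S : {vspace rtens}) :
  (forall i m n, m \in par M i -> n \in par N (i (+) c) -> rt m n \in S) ->
  (rpar c <= S)%VS.
Proof.
move=> h; apply/subv_sumP => i _; apply/span_subvP => x /allpairsP[[m n] /= [mi ni ->]].
by apply: (h i); apply: vbasis_mem.
Qed.

Lemma rt_par i j m n : m \in par M i -> n \in par N j -> rt m n \in rpar (i (+) j).
Proof.
move=> mi nj; have nj' : n \in par N (i (+) (i (+) j)) by rewrite addKb.
apply: (subvP (sumv_sup i _ (subvv _))) => //.
rewrite (coord_vbasis mi) (lin_sum _ _ _ (rt_linl _)); apply: memv_suml => a _.
rewrite (linZ _ _ (rt_linl _)) memvZ // (coord_vbasis nj').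
rewrite (lin_sum _ _ _ (rt_linr _)); apply: memv_suml => b _.
rewrite (linZ _ _ (rt_linr _)) memvZ // memv_span //.
by rewrite allpairs_f // mem_nth // size_tuple.
Qed.

Let P c (m : M) (n : N) : rtens :=
  \sum_(i : bool) rt (pproj i m) (pproj (i (+) c) n).

Let PE c i j m n : m \in par M i -> n \in par N j ->
  P c m n = if i (+) j == c then rt m n else 0.
Proof.
move=> mi nj; rewrite /P big_bool /= !(pprojE _ mi) !(pprojE _ nj).
case: i j c {mi nj} => [] [] [] /=;
  rewrite ?(lin0 (rt_linl _)) ?(lin0 (rt_linr _)) ?addr0 ?add0r //.
Qed.

Let P_linl c n : linear (P c ^~ n).
Proof.
move=> a x y; rewrite /P scaler_sumr -big_split; apply: eq_bigr => i _ /=.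
by rewrite linearP rt_linl.
Qed.

Let P_linr c m : linear (P c m).
Proof.
move=> a x y; rewrite /P scaler_sumr -big_split; apply: eq_bigr => i _ /=.
by rewrite linearP rt_linr.
Qed.

Let P_balanced c m b n : P c (ract m b) n = P c m (lact b n).
Proof.
move: m; apply: homog_ext.
- by move=> a x y; rewrite ract_linl P_linl.
- by move=> a x y; rewrite P_linl.
move=> i m mi; move: b; apply: homog_ext.
- by move=> a x y; rewrite ract_linr P_linl.
- by move=> a x y; rewrite lact_linl P_linr.
move=> j b bj; move: n; apply: homog_ext.
- exact: P_linr.
- by move=> a x y; rewrite lact_linr P_linr.
move=> l n nl; rewrite (PE _ (ract_par mi bj) nl) (PE _ mi (lact_par bj nl)).
by rewrite addbA rt_balanced.
Qed.

Let PP c : 'End(rtens) := linfun (rlift (P c)).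

Let PPE c m n : PP c (rt m n) = P c m n.
Proof.
by rewrite /PP (linfun_linE (rlift_lin _)) rliftE.
Qed.

Let PP_id c x : x \in rpar c -> PP c x = x.
Proof.
have /subvP h : (rpar c <= lker (PP c - \1%VF))%VS.
  apply: rpar_sub => i m n mi nj; rewrite memv_ker !lfun_simp PPE (PE _ mi nj).
  by rewrite addKb eqxx subrr.
by move/h; rewrite memv_ker !lfun_simp subr_eq0 => /eqP.
Qed.

Let PP_0 c x : x \in rpar (~~ c) -> PP c x = 0.
Proof.
have /subvP h : (rpar (~~ c) <= lker (PP c))%VS.
  apply: rpar_sub => i m n mi nj; rewrite memv_ker PPE (PE _ mi nj).
  by rewrite addKb; case: c {mi nj}.
by move/h; rewrite memv_ker => /eqP.
Qed.

Lemma rpar_direct : (rpar false :&: rpar true)%VS = 0%VS.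
Proof.
apply/eqP; rewrite -subv0; apply/subvP => x.
rewrite memv_cap memv0 => /andP[x0 x1].
by rewrite -(PP_id x0) (PP_0 (c := false)).
Qed.

Lemma rpar_full : (rpar false + rpar true)%VS = fullv.
Proof.
apply/vspaceP => x; rewrite memvf; apply: rt_mem => m n.
rewrite (pproj_sum m) (linD _ _ (rt_linl _)) (pproj_sum n) !(linD _ _ (rt_linr _)).
have h i j : rt (pproj i m) (pproj j n) \in (rpar false + rpar true)%VS.
  have := rt_par (pproj_par i m) (pproj_par j n).
  by apply: subvP; case: (i (+) j); rewrite ?addvSl ?addvSr.
by rewrite !memvD.
Qed.

Definition rsvect : svect := SVect rpar_direct rpar_full.

Definition rlact (c : C) (x : rsvect) : rsvect :=
  rlift (fun m n => rt (lact c m) n) x.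
Definition rract (x : rsvect) (a : A) : rsvect :=
  rlift (fun m n => rt m (ract n a)) x.

Lemma rlactE c m n : rlact c (rt m n) = rt (lact c m) n.
Proof.
rewrite /rlact rliftE // => [y a u v|x a u v|x b y].
- by rewrite lact_linr rt_linl.
- by rewrite rt_linr.
- by rewrite -lractA rt_balanced.
Qed.

Lemma rractE a m n : rract (rt m n) a = rt m (ract n a).
Proof.
rewrite /rract rliftE // => [y c u v|x c u v|x b y].
- by rewrite rt_linl.
- by rewrite ract_linl rt_linr.
- by rewrite rt_balanced lractA.
Qed.

Lemma rlact_linl m : linear (rlact^~ m).
Proof.
apply: rlift_fun_lin => x y a u v; by rewrite lact_linl rt_linl.
Qed.

Lemma rlact_linr c : linear (rlact c). Proof. exact: rlift_lin. Qed.
Lemma rract_linl a : linear (rract^~ a). Proof. exact: rlift_lin. Qed.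

Lemma rract_linr m : linear (rract m).
Proof.
apply: rlift_fun_lin => x y a u v; by rewrite ract_linr rt_linr.
Qed.

Lemma rpar_map (S : svect) (f : rsvect -> S) c d : linear f ->
  (forall i m n, m \in par M i -> n \in par N (i (+) c) -> f (rt m n) \in par S d) ->
  forall x, x \in rpar c -> f x \in par S d.
Proof.
move=> lf h x xc; rewrite -(linfun_linE lf) memv_preim.
apply: subvP xc; apply: rpar_sub => i m n mi ni.
by rewrite -memv_preim (linfun_linE lf) (h i).
Qed.

Definition rbimod : bimod C A.
Proof.
refine (@BiMod C A rsvect rlact rract rlact_linl rlact_linr rract_linl rract_linr
  _ _ _ _ _ _ _).
- move=> c c'; apply: rt_ext => [||m n].
  + exact: rlact_linr.
  + by apply: lin_comp; exact: rlact_linr.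
  + by rewrite !rlactE lactM.
- move=> m a a'; move: m; apply: rt_ext => [||m n].
  + exact: rract_linl.
  + by apply: (lin_comp (rract_linl _)); exact: rract_linl.
  + by rewrite !rractE ractM.
- apply: rt_ext => [||m n]; [exact: rlact_linr|exact: lin_id|].
  by rewrite rlactE lact1.
- apply: rt_ext => [||m n]; [exact: rract_linl|exact: lin_id|].
  by rewrite rractE ract1.
- move=> c m a; move: m; apply: rt_ext => [||m n].
  + by apply: (lin_comp (rract_linl _)); exact: rlact_linr.
  + by apply: (lin_comp (rlact_linr _)); exact: rract_linl.
  + by rewrite !(rlactE, rractE).
- move=> i j c x ci; apply: (rpar_map (rlact_linr c)) => l m n ml nl.
  rewrite rlactE -[i (+) j](_ : (i (+) l) (+) (l (+) j) = _); last first.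
    by rewrite -addbA addKb.
  by apply: rt_par => //; apply: lact_par.
- move=> i j x a xi aj; move: x xi; apply: (rpar_map (rract_linl a)) => l m n ml nl.
  rewrite rractE -[i (+) j](_ : l (+) ((l (+) i) (+) j) = _); last first.
    by rewrite -addbA addKb.
  by apply: rt_par => //; apply: ract_par.
Defined.

Lemma rbimod_ext (W : lmodType k) (f g : rbimod -> W) :
  linear f -> linear g -> (forall m n, f (rt m n) = g (rt m n)) -> f =1 g.
Proof. exact: rt_ext. Qed.

End RelTensor.

Arguments rt {C B A M N} m n.

Definition mk_bimap (B A : salg) (M N : bimod B A) (f : M -> N)
    (lf : linear f) (fL : forall b m, f (lact b m) = lact b (f m))
    (fR : forall m a, f (ract m a) = ract (f m) a)
    (fp : forall i m, m \in par M i -> f m \in par N i) : bimap M N.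
Proof.
by refine (@BiMap B A M N (linfun f) _ _ _) => *;
  rewrite !(linfun_linE lf); [apply: fL|apply: fR|apply: fp].
Defined.

Lemma mk_bimapE (B A : salg) (M N : bimod B A) (f : M -> N) lf fL fR fp m :
  @mk_bimap B A M N f lf fL fR fp m = f m.
Proof. exact: linfun_linE. Qed.

Lemma bimap_lin (B A : salg) (M N : bimod B A) (f : bimap M N) : linear f.
Proof. exact: linear_lfun. Qed.

Section RtBimap.
Variables (C B A : salg) (M : bimod C B) (N : bimod B A) (W : bimod C A).
Variable f : M -> N -> W.
Hypotheses (fl : forall n, linear (f^~ n)) (fr : forall m, linear (f m)).
Hypothesis fb : forall m b n, f (ract m b) n = f m (lact b n).
Hypothesis fL : forall c m n, f (lact c m) n = lact c (f m n).
Hypothesis fR : forall m n a, f m (ract n a) = ract (f m n) a.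
Hypothesis fp : forall i j m n, m \in par M i -> n \in par N j ->
  f m n \in par W (i (+) j).

Definition rt_bimap : bimap (rbimod M N) W.
Proof.
refine (@mk_bimap _ _ (rbimod M N) W (rlift f) (rlift_lin f) _ _ _).
- move=> c; apply: rbimod_ext => [||m n].
  + by apply: (lin_comp (rlift_lin _)); exact: lact_linr.
  + by apply: lin_comp; [exact: lact_linr|exact: rlift_lin].
  + by rewrite /= rlactE !rliftE.
- move=> m a; move: m; apply: rbimod_ext => [||m n].
  + by apply: (lin_comp (rlift_lin _)); exact: ract_linl.
  + by apply: (lin_comp (ract_linl _)); exact: rlift_lin.
  + by rewrite /= rractE !rliftE.
- move=> i; apply: rpar_map; first exact: rlift_lin.
  move=> j m n mj nj; rewrite rliftE // -{1}(addKb j i).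
  exact: fp.
Defined.

Lemma rt_bimapE m n : rt_bimap (rt m n) = f m n.
Proof. by rewrite mk_bimapE rliftE. Qed.

End RtBimap.

Section Structure.
Implicit Types A B C D E : salg.

Definition bid B A (M : bimod B A) : bimap M M.
Proof. exact: (@mk_bimap _ _ M M (fun x => x)). Defined.

Lemma bidE B A (M : bimod B A) x : bid M x = x.
Proof. exact: mk_bimapE. Qed.

Definition bcomp B A (M N P : bimod B A) (g : bimap N P) (f : bimap M N) :
  bimap M P.
Proof.
refine (@BiMap _ _ M P (g \o f)%VF _ _ _) => [b m|m a|i m mi].
- by rewrite !comp_lfunE !bm_lact.
- by rewrite !comp_lfunE !bm_ract.
- by rewrite comp_lfunE !bm_par.
Defined.

Lemma bcompE B A (M N P : bimod B A) (g : bimap N P) (f : bimap M N) x :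
  bcomp g f x = g (f x).
Proof. exact: comp_lfunE. Qed.

(* [A] as an [A]-[A]-bimodule *)
Definition regular A : bimod A A.
Proof.
refine (@BiMod A A (sa_svect A) (@smul A) (@smul A) (@smul_linl A)
  (@smul_linr A) (@smul_linl A) (@smul_linr A) _ _ _ _ _ _ _) => *.
- by rewrite smulA.
- by rewrite smulA.
- exact: smul1l.
- exact: smul1r.
- by rewrite smulA.
- exact: smul_par.
- exact: smul_par.
Defined.

Definition rmap C B A (M M' : bimod C B) (N N' : bimod B A)
  (g : bimap M M') (f : bimap N N') : bimap (rbimod M N) (rbimod M' N').
Proof.
refine (@rt_bimap _ _ _ M N (rbimod M' N') (fun m n => rt (g m) (f n))
  _ _ _ _ _ _).
- by move=> n a x y; rewrite linearP rt_linl.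
- by move=> m a x y; rewrite linearP rt_linr.
- by move=> m b n; rewrite bm_ract bm_lact rt_balanced.
- by move=> c m n; rewrite bm_lact /= rlactE.
- by move=> m n a; rewrite bm_ract /= rractE.
- by move=> i j m n mi nj; apply: rt_par; apply: bm_par.
Defined.

Lemma rmapE C B A (M M' : bimod C B) (N N' : bimod B A)
  (g : bimap M M') (f : bimap N N') m n : rmap g f (rt m n) = rt (g m) (f n).
Proof. exact: rt_bimapE. Qed.

Section Associator.
Variables (A B C D : salg) (P : bimod D C) (N : bimod C B) (M : bimod B A).

Let rassoc_fun (x : rbimod P N) (m : M) : rbimod P (rbimod N M) :=
  rlift (fun p n => rt p (rt n m : rbimod N M)) x.

Let rassoc_funE p n m : rassoc_fun (rt p n) m = rt p (rt n m : rbimod N M).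
Proof.
rewrite /rassoc_fun rliftE // => [y|x|x b y].
- by move=> a u v; rewrite rt_linl.
- by move=> a u v; rewrite rt_linl rt_linr.
- by rewrite rt_balanced /= rlactE.
Qed.

Let rassoc_linl m : linear (rassoc_fun^~ m).
Proof. exact: rlift_lin. Qed.

Let rassoc_linr x : linear (rassoc_fun x).
Proof. by apply: rlift_fun_lin => p n a u v; rewrite !rt_linr. Qed.

Definition rassoc : bimap (rbimod (rbimod P N) M) (rbimod P (rbimod N M)).
Proof.
refine (@rt_bimap _ _ _ _ _ _ rassoc_fun rassoc_linl rassoc_linr _ _ _ _).
- move=> x b m; move: x; apply: rbimod_ext => [||p n].
  + by apply: (lin_comp (rassoc_linl _)); exact: ract_linl.
  + exact: rassoc_linl.
  + by rewrite /= rractE !rassoc_funE rt_balanced.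
- move=> d x m; move: x; apply: rbimod_ext => [||p n].
  + by apply: (lin_comp (rassoc_linl _)); exact: lact_linr.
  + by apply: lin_comp (rassoc_linl _); exact: lact_linr.
  + by rewrite /= rlactE !rassoc_funE rlactE.
- move=> x m a; move: x; apply: rbimod_ext => [||p n].
  + exact: rassoc_linl.
  + by apply: lin_comp (rassoc_linl _); exact: ract_linl.
  + by rewrite !rassoc_funE /= rractE /= rractE.
- move=> i j x m + mj; apply: (rpar_map (rassoc_linl m)) => l p n pl nl; rewrite rassoc_funE.
  rewrite -[i (+) j](_ : l (+) ((l (+) i) (+) j) = _); last by rewrite -addbA addKb.
  by apply: rt_par => //; apply: rt_par.
Defined.

Lemma rassocE p n m :
  rassoc (rt (rt p n : rbimod P N) m) = rt p (rt n m : rbimod N M).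
Proof. by rewrite rt_bimapE. Qed.

Let rassocV_fun (p : P) (x : rbimod N M) : rbimod (rbimod P N) M :=
  rlift (fun n m => rt (rt p n : rbimod P N) m) x.

Let rassocV_funE p n m : rassocV_fun p (rt n m) = rt (rt p n : rbimod P N) m.
Proof.
rewrite /rassocV_fun rliftE // => [y|x|x b y].
- by move=> a u v; rewrite rt_linr rt_linl.
- by move=> a u v; rewrite rt_linr.
- by rewrite -rt_balanced /= rractE.
Qed.

Let rassocV_linr p : linear (rassocV_fun p).
Proof. exact: rlift_lin. Qed.

Let rassocV_linl x : linear (rassocV_fun^~ x).
Proof. by apply: rlift_fun_lin => n m a u v; rewrite !rt_linl. Qed.

Definition rassocV : bimap (rbimod P (rbimod N M)) (rbimod (rbimod P N) M).
Proof.
refine (@rt_bimap _ _ _ _ _ _ rassocV_fun rassocV_linl rassocV_linr _ _ _ _).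
- move=> p c; apply: rbimod_ext => [||n m].
  + exact: rassocV_linr.
  + by apply: (lin_comp (rassocV_linr _)); exact: lact_linr.
  + by rewrite /= rlactE !rassocV_funE rt_balanced.
- move=> d p; apply: rbimod_ext => [||n m].
  + exact: rassocV_linr.
  + by apply: lin_comp (rassocV_linr _); exact: lact_linr.
  + by rewrite /= !rassocV_funE rlactE /= rlactE.
- move=> p x a; move: x; apply: rbimod_ext => [||n m].
  + by apply: (lin_comp (rassocV_linr _)); exact: ract_linl.
  + by apply: lin_comp (rassocV_linr _); exact: ract_linl.
  + by rewrite /= rractE !rassocV_funE rractE.
- move=> i j p x pi; move: x; apply: (rpar_map (rassocV_linr p)) => l n m nl ml; rewrite rassocV_funE.
  rewrite -[i (+) j](_ : (i (+) l) (+) (l (+) j) = _); last by rewrite -addbA addKb.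
  by apply: rt_par => //; apply: rt_par.
Defined.

Lemma rassocVE p n m :
  rassocV (rt p (rt n m : rbimod N M)) = rt (rt p n : rbimod P N) m.
Proof. by rewrite rt_bimapE. Qed.

End Associator.

Section Unitors.
Variables (A B : salg) (M : bimod B A).

Definition lunitor : bimap (rbimod (regular B) M) M.
Proof.
refine (@rt_bimap _ _ _ (regular B) M M (fun b m => lact (b : B) m) _ _ _ _ _ _).
- exact: lact_linl.
- exact: lact_linr.
- by move=> b c m; rewrite lactM.
- by move=> c b m; rewrite lactM.
- by move=> b m a; rewrite lractA.
- by move=> i j b m; exact: lact_par.
Defined.

Lemma lunitorE b m : lunitor (rt (b : regular B) m) = lact b m.
Proof. exact: rt_bimapE. Qed.

Definition lunitorV : bimap M (rbimod (regular B) M).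
Proof.
refine (@mk_bimap _ _ M (rbimod (regular B) M)
  (fun m => rt (sone B : regular B) m) _ _ _ _).
- exact: rt_linr.
- move=> b m; rewrite -rt_balanced /= rlactE /= smul1l.
  by rewrite smul1r.
- by move=> m a; rewrite /= rractE.
- by move=> i m mi; apply: (rt_par (i := false)) => //; exact: sone_par.
Defined.

Lemma lunitorVE m : lunitorV m = rt (sone B : regular B) m.
Proof. exact: mk_bimapE. Qed.

Definition runitor : bimap (rbimod M (regular A)) M.
Proof.
refine (@rt_bimap _ _ _ M (regular A) M (fun m a => ract m (a : A)) _ _ _ _ _ _).
- exact: ract_linl.
- exact: ract_linr.
- by move=> m a c; rewrite -ractM.
- by move=> c m a; rewrite lractA.
- by move=> m a c; rewrite -ractM.
- by move=> i j m a; exact: ract_par.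
Defined.

Lemma runitorE m a : runitor (rt m (a : regular A)) = ract m a.
Proof. exact: rt_bimapE. Qed.

Definition runitorV : bimap M (rbimod M (regular A)).
Proof.
refine (@mk_bimap _ _ M (rbimod M (regular A))
  (fun m => rt m (sone A : regular A)) _ _ _ _).
- exact: rt_linl.
- by move=> b m; rewrite /= rlactE.
- move=> m a; rewrite rt_balanced /= rractE /= smul1l.
  by rewrite smul1r.
- move=> i m mi; rewrite -(addbF i).
  by apply: rt_par => //; exact: sone_par.
Defined.

Lemma runitorVE m : runitorV m = rt m (sone A : regular A).
Proof. exact: mk_bimapE. Qed.

End Unitors.

Definition tensE :=
  (bcompE, bidE, rmapE, rassocE, rassocVE, lunitorE, lunitorVE, runitorE, runitorVE).

Lemma bimap_ext2 C B A (M : bimod C B) (N : bimod B A) (W : bimod C A)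
    (f g : bimap (rbimod M N) W) :
  (forall m n, f (rt m n) = g (rt m n)) -> f = g.
Proof.
move=> e; apply: bimap_eq; apply: rbimod_ext => //; exact: bimap_lin.
Qed.

Lemma bimap_ext3l D C B A (P : bimod D C) (N : bimod C B) (M : bimod B A)
    (W : bimod D A) (f g : bimap (rbimod (rbimod P N) M) W) :
  (forall p n m, f (rt (rt p n : rbimod P N) m) = g (rt (rt p n : rbimod P N) m)) ->
  f = g.
Proof.
move=> e; apply: bimap_ext2 => x m; move: x; apply: rbimod_ext => //.
- by apply: (lin_comp (bimap_lin _)); exact: rt_linl.
- by apply: (lin_comp (bimap_lin _)); exact: rt_linl.
Qed.

Lemma bimap_ext3r D C B A (P : bimod D C) (N : bimod C B) (M : bimod B A)
    (W : bimod D A) (f g : bimap (rbimod P (rbimod N M)) W) :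
  (forall p n m, f (rt p (rt n m : rbimod N M)) = g (rt p (rt n m : rbimod N M))) ->
  f = g.
Proof.
move=> e; apply: bimap_ext2 => p; apply: rbimod_ext => //.
- by apply: (lin_comp (bimap_lin _)); exact: rt_linr.
- by apply: (lin_comp (bimap_lin _)); exact: rt_linr.
Qed.

Lemma bimap_ext4l E D C B A (Q : bimod E D) (P : bimod D C) (N : bimod C B)
    (M : bimod B A) (W : bimod E A)
    (f g : bimap (rbimod (rbimod (rbimod Q P) N) M) W) :
  (forall q p n m,
    f (rt (rt (rt q p : rbimod Q P) n : rbimod (rbimod Q P) N) m)
    = g (rt (rt (rt q p : rbimod Q P) n : rbimod (rbimod Q P) N) m)) ->
  f = g.
Proof.
move=> e; apply: bimap_ext3l => x n m; move: x; apply: rbimod_ext => //.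
- apply: (lin_comp (bimap_lin _)); apply: (lin_comp (rt_linl _)).
  exact: rt_linl.
- apply: (lin_comp (bimap_lin _)); apply: (lin_comp (rt_linl _)).
  exact: rt_linl.
Qed.

End Structure.

(** * The bicategory of finite-dimensional super algebras over [k]

    A 1-morphism [A -> B] is a graded [B]-[A]-bimodule. *)

Definition s2Vect : bicategory.
Proof.
refine (@Bicategory salg (fun A B => bimod B A) (fun _ _ => @bimap _ _)
  regular (fun _ _ _ => @rbimod _ _ _) (fun _ _ => @bid _ _)
  (fun _ _ => @bcomp _ _) (fun _ _ _ M M' N N' => @rmap _ _ _ M M' N N')
  (fun _ _ _ _ => @rassoc _ _ _ _) (fun _ _ _ _ => @rassocV _ _ _ _)
  (fun _ _ => @lunitor _ _) (fun _ _ => @lunitorV _ _)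
  (fun _ _ => @runitor _ _) (fun _ _ => @runitorV _ _)
  _ _ _ _ _ _ _ _ _ _ _ _ _ _ _ _) => /=.
- by move=> *; apply: bimap_eq => m; rewrite !tensE.
- by move=> *; apply: bimap_eq => m; rewrite !tensE.
- by move=> *; apply: bimap_eq => m; rewrite !tensE.
- by move=> *; apply: bimap_ext2 => m n; rewrite !tensE.
- by move=> *; apply: bimap_ext2 => m n; rewrite !tensE.
- by move=> *; apply: bimap_ext3l => p n m; rewrite !tensE.
- by move=> *; apply: bimap_ext2 => m n; rewrite !tensE bm_lact.
- by move=> *; apply: bimap_ext2 => m n; rewrite !tensE bm_ract.
- by move=> *; apply: bimap_ext3l => p n m; rewrite !tensE.
- by move=> *; apply: bimap_ext3r => p n m; rewrite !tensE.
- move=> *; apply: bimap_ext2 => m n; rewrite !tensE.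
  by rewrite -rt_balanced /= smul1l.
- by move=> *; apply: bimap_eq => m; rewrite !tensE lact1.
- move=> *; apply: bimap_ext2 => m n; rewrite !tensE.
  by rewrite rt_balanced /= smul1r.
- by move=> *; apply: bimap_eq => m; rewrite !tensE ract1.
- by move=> *; apply: bimap_ext3l => p n m; rewrite !tensE rt_balanced.
- by move=> *; apply: bimap_ext4l => q p n m; rewrite !tensE.
Defined.

End Super.

(** * Lie groups and smoothness *)

Section Smooth.
Variable R : realType.
Local Open Scope classical_set_scope.

Fixpoint Cn (V W : normedModType R) (n : nat) (U : set V) (f : V -> W) : Prop :=
  (forall x, U x -> {for x, continuous f}) /\
  match n with
  | 0 => True
  | n'.+1 => forall v, (forall x, U x -> derivable f x v) /\ Cn n' U ('D_v f)
  end.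

Definition smooth_on (V W : normedModType R) (U : set V) (f : V -> W) : Prop :=
  forall n, Cn n U f.

(* A chart is a homeomorphism [ch_map], with inverse [ch_inv], from the open
   set [ch_dom] onto an open subset [ch_cod] of [R^n]; the values of [ch_map]
   and [ch_inv] outside of these sets are irrelevant. *)
Record chart (X : topologicalType) (n : nat) := Chart {
  ch_dom : set X;
  ch_cod : set 'rV[R]_n;
  ch_map : X -> 'rV[R]_n;
  ch_inv : 'rV[R]_n -> X;
  ch_dom_open : open ch_dom;
  ch_cod_open : open ch_cod;
  ch_map_cod : forall x, ch_dom x -> ch_cod (ch_map x);
  ch_inv_dom : forall y, ch_cod y -> ch_dom (ch_inv y);
  ch_mapK : forall x, ch_dom x -> ch_inv (ch_map x) = x;
  ch_invK : forall y, ch_cod y -> ch_map (ch_inv y) = y;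
  ch_map_cont : forall x, ch_dom x -> {for x, continuous ch_map};
  ch_inv_cont : forall y, ch_cod y -> {for y, continuous ch_inv}
}.

Record abLieGroup := AbLieGroup {
  lie_car :> topologicalZmodType;
  lie_hausdorff : hausdorff_space lie_car;
  lie_countable : @second_countable lie_car;
  lie_dim : nat;
  lie_atlas : set (chart lie_car lie_dim);
  lie_cover : forall a, exists2 c, lie_atlas c & ch_dom c a;
  lie_transition : forall c d, lie_atlas c -> lie_atlas d ->
    smooth_on [set y | ch_cod c y /\ ch_dom d (ch_inv c y)]
      (fun y => ch_map d (ch_inv c y));
  lie_add : forall c d e, lie_atlas c -> lie_atlas d -> lie_atlas e ->
    smooth_on
      [set y : 'rV[R]_(lie_dim + lie_dim) |
        [/\ ch_cod c (lsubmx y), ch_cod d (rsubmx y)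
          & ch_dom e (ch_inv c (lsubmx y) + ch_inv d (rsubmx y))]]
      (fun y => ch_map e (ch_inv c (lsubmx y) + ch_inv d (rsubmx y)));
  lie_opp : forall c d, lie_atlas c -> lie_atlas d ->
    smooth_on [set y | ch_cod c y /\ ch_dom d (- ch_inv c y)]
      (fun y => ch_map d (- ch_inv c y))
}.

Definition smooth_real (A : abLieGroup) (f : A -> R) : Prop :=
  forall c, lie_atlas c ->
    smooth_on (ch_cod c) (fun y => f (ch_inv c y) : R^o).

(* Topologically finitely generated; a group that is finitely generated as an
   abstract group is so in particular. *)
Definition finitely_generated (A : abLieGroup) : Prop :=
  exists (n : nat) (g : 'I_n -> A),
    closure [set a | exists z : 'I_n -> int, a = \sum_i g i *~ z i] = setT.

(* The smooth structure on the ground field: the usual one on the real and on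
   the complex numbers, and that of a discrete set on any other field. *)
Inductive smooth_field : fieldType -> Type :=
| RealField : smooth_field R
| ComplexField : smooth_field (R[i])
| DiscreteField (k : fieldType) : smooth_field k.

Definition smooth_scalar (A : abLieGroup) (k : fieldType) (s : smooth_field k) :
    (A -> k) -> Prop :=
  match s in smooth_field k return (A -> k) -> Prop with
  | RealField => fun f => smooth_real f
  | ComplexField => fun f =>
      smooth_real (fun a => complex.Re (f a)) /\
      smooth_real (fun a => complex.Im (f a))
  | DiscreteField k => fun f => forall a, \forall b \near a, f b = f a
  end.

(* A map to a finite-dimensional space is smooth if its composites with all
   linear forms are. *)
Definition smooth_vect (A : abLieGroup) (k : fieldType) (s : smooth_field k)
    (V : vectType k) (f : A -> V) : Prop :=
  forall phi : {scalar V}, smooth_scalar s (fun a => phi (f a)).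

End Smooth.

(** * Objects of [2Rep(BA)] *)

Section TwoRep.
Variables (R : realType) (k : fieldType) (s : smooth_field R k).
Variable A : abLieGroup R.

(* On objects and 1-morphisms of [BBA] there is no smoothness to ask for, so
   that 1- and 2-morphisms of [2Rep(BA)] are all strong transformations and all
   modifications. *)
Record two_rep := TwoRep {
  rep_pf :> pseudofunctor (BBA A) (s2Vect k);
  rep_smooth : smooth_vect s
    (fun a : A => bm_fun (@pf_2 _ _ rep_pf tt tt tt tt a))
}.

(* Smooth group homomorphisms from [A] to the group of automorphisms of the
   bimodule [D]; invertibility of [aut_fun a] follows from the two laws. *)
Record smooth_aut (D : salg k) := SmoothAut {
  aut_fun :> A -> bimap (regular D) (regular D);
  aut0 : aut_fun 0 = bid (regular D);
  autD : forall a b, aut_fun (a + b) = bcomp (aut_fun a) (aut_fun b);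
  aut_smooth : smooth_vect s (fun a => bm_fun (aut_fun a))
}.

Lemma iso2_id (C : bicategory) (a b : C) (f : hom1 a b) : iso2 (id2 f).
Proof. by exists (id2 f); rewrite vcomp1l. Qed.

Lemma iso2_lunit (C : bicategory) (a b : C) (f : hom1 a b) : iso2 (lunit f).
Proof. by exists (lunitV f); rewrite lunitK lunitVK. Qed.

(* The data [(D, D, l_D, id_D, beta)] *)
Definition normal_pf (D : salg k) (beta : smooth_aut D) :
  pseudofunctor (BBA A) (s2Vect k).
Proof.
refine (@Pseudofunctor (BBA A) (s2Vect k) (fun _ => D)
  (fun _ _ _ => id1 (D : s2Vect k)) (fun _ _ _ _ a => beta a)
  (fun _ _ _ _ _ => lunit (id1 (D : s2Vect k)))
  (fun _ => id2 (id1 (D : s2Vect k))) _ _ _ _ _ _ _ _) => /=.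
- by move=> *; exact: aut0.
- by move=> *; exact: autD.
- by move=> *; exact: iso2_lunit.
- by move=> *; exact: iso2_id.
- move=> _ _ _ _ _ _ _ b a; apply: bimap_ext2 => x y; rewrite !tensE /=.
  have e (z : regular D) : beta (b + a) z = beta b (beta a z).
    by rewrite autD bcompE.
  have ea : beta a (smul x y) = smul (x : D) (beta a y) := bm_lact (beta a) x y.
  have eb (z : D) : beta b (smul x z) = smul (beta b x) z := bm_ract (beta b) x z.
  by move: (e (smul x y)); rewrite ea eb.
- move=> _ _ _ _ _ _ _; apply: bimap_ext3l => x y z.
  by rewrite !tensE aut0 !tensE /= smulA.
- move=> _ _ _; apply: bimap_ext2 => x y.
  by rewrite !tensE aut0 !tensE.
- move=> _ _ _; apply: bimap_ext2 => x y.
  by rewrite !tensE aut0 !tensE.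
Defined.

Definition normal_rep (D : salg k) (beta : smooth_aut D) : two_rep :=
  @TwoRep (normal_pf beta) (aut_smooth beta).

(* An equivalence whose 1-morphism is the identity [D] of [D]. Without
   this condition [beta] is determined only up to internal equivalence: for
   [D = k x k], the bimodule [D] twisted by the swap of the two factors gives an
   equivalence between [(beta1, beta2)] and [(beta2, beta1)]. *)
Definition equivalent_over_id (F : two_rep) (beta : smooth_aut (F tt)) : Prop :=
  exists t : transformation F (normal_rep beta),
    equivalence t /\ tr_1 t tt = regular (F tt).

End TwoRep.

(* Main.v *)
(* Write M and u : D -> M for the bimodule and the unitor of F, and let
   c_F(a) in D be the element with alpha(a)(u(1)) = u(c_F(a)); it is central and
   determines alpha. Every 1-morphism of BBA is an identity, so the unit axiom
   forces the 2-cell of a strong transformation F -> G on a bimodule S to be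
   u_G(d) (x) x |-> d x (x) u_F(1). With this 2-cell the multiplicativity axiom
   and the modification axiom hold automatically, and naturality says
   c_G(a) x = x c_F(a) for all x in S. Hence internal equivalence of F and G
   amounts to a pair of inverse bimodules with this property, which depends on F
   only through c_F. Conjugating alpha by u gives a beta with c_beta = c_F, so
   that D itself is an equivalence; conversely an equivalence carried by D forces
   c_beta = c_F, by the naturality condition at x = 1. *)

Require Import Defs.
From HB Require Import structures.
From mathcomp Require Import all_boot all_order all_algebra.
From mathcomp Require Import all_classical all_reals all_analysis.

Set Implicit Arguments.
Unset Strict Implicit.
Unset Printing Implicit Defensive.

Import GRing.Theory.
Local Open Scope ring_scope.
Local Open Scope bicat_scope.

Lemma bimap_app (k : fieldType) (B A : salg k) (M N : bimod B A)
    (f g : bimap M N) : f = g -> forall x, f x = g x.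
Proof. by move=> ->. Qed.

(** * 2-cells subject to the unit axiom, over a fixed bimodule *)

Section UnitalBimaps.
Variables (k : fieldType) (X Y : salg k) (P : bimod X X) (N : bimod Y Y).
Variables (p0 : bimap (regular X) P) (pV : bimap P (regular X)).
Variables (n0 : bimap (regular Y) N) (nV : bimap N (regular Y)).
Hypotheses (p0K : cancel p0 pV) (pVK : cancel pV p0).
Hypotheses (n0K : cancel n0 nV) (nVK : cancel nV n0).

Lemma unit_lact d : p0 d = lact d (p0 (sone X)).
Proof. by rewrite -bm_lact /= smul1r. Qed.

Lemma unit_ract d : p0 d = ract (p0 (sone X)) d.
Proof. by rewrite -bm_ract /= smul1l. Qed.

(** [p0 (sone X)] generates [P] from the left, and from the right in the next lemma, so one element
    of [X] determines [a]. *)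
Lemma endo_unit_smull (a : bimap P P) d :
  a (p0 d) = p0 (smul d (pV (a (p0 (sone X))))).
Proof.
by rewrite unit_lact bm_lact -[smul d _]/(lact _ _) (bm_lact p0) pVK.
Qed.

Lemma endo_unit_smulr (a : bimap P P) d :
  a (p0 d) = p0 (smul (pV (a (p0 (sone X)))) d).
Proof.
by rewrite unit_ract bm_ract -[smul _ d]/(ract _ _) (bm_ract p0) pVK.
Qed.

Section OneBimodule.
Variable S : bimod Y X.
Implicit Type f : bimap (rbimod N S) (rbimod S P).

(** The unit axiom on elements, with [p0] and [n0] the unitors of source and target. As [n0] is
    bijective, it determines [f]. *)
Definition unital f :=
  forall d x, f (rt (n0 d) x) = rt (lact d x) (p0 (sone X)).

Lemma unitalP f :
  bcomp f (rmap n0 (bid S))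
    = bcomp (rmap (bid S) p0) (bcomp (runitorV S) (lunitor S)) <-> unital f.
Proof.
split=> [e d x|uf].
- have := bimap_app e (rt (d : regular Y) x).
  by rewrite !bcompE rmapE bidE lunitorE runitorVE rmapE bidE.
- apply: bimap_ext2 => d x.
  by rewrite !bcompE rmapE uf bidE lunitorE runitorVE rmapE bidE.
Qed.

Definition unital_map : bimap (rbimod N S) (rbimod S P) :=
  bcomp (rmap (bid S) p0)
    (bcomp (runitorV S) (bcomp (lunitor S) (rmap nV (bid S)))).

Lemma unital_mapP : unital unital_map.
Proof.
move=> d x; rewrite /unital_map 3!bcompE rmapE n0K bidE lunitorE runitorVE.
by rewrite rmapE bidE.
Qed.

(** The inverse sends [rt x (p0 d)] to [rt (n0 (sone Y)) (ract x d)]. *)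
Lemma unital_bij f : unital f ->
  exists g, bcomp g f = bid (rbimod N S) /\ bcomp f g = bid (rbimod S P).
Proof.
move=> uf; pose g : bimap (rbimod S P) (rbimod N S) :=
  bcomp (rmap n0 (bid S))
    (bcomp (lunitorV S) (bcomp (runitor S) (rmap (bid S) pV))).
have gE x d : g (rt x (p0 d)) = rt (n0 (sone Y)) (ract x d).
  rewrite /g 3!bcompE rmapE bidE p0K runitorE lunitorVE.
  by rewrite rmapE bidE.
exists g; split.
- apply: bimap_ext2 => y x; rewrite -(nVK y) bcompE bidE uf gE ract1.
  by rewrite -rt_balanced -bm_ract /= smul1l.
- apply: bimap_ext2 => x y; rewrite -(pVK y) bcompE bidE gE uf lact1.
  by rewrite rt_balanced -unit_lact.
Qed.

End OneBimodule.

Lemma rt_unit_inj (S : bimod Y X) (x y : S) :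
  rt x (p0 (sone X)) = rt y (p0 (sone X)) -> x = y.
Proof.
move/(congr1 (fun z => runitor S (rmap (bid S) pV z))).
by rewrite !rmapE !bidE p0K !runitorE !ract1.
Qed.

(** By left linearity of [m], both sides send [rt (n0 d) x] to [rt (lact d (m x)) (p0 (sone X))]. *)
Lemma unital_modif (S T : bimod Y X) (m : bimap S T) f g :
  unital f -> unital g ->
  bcomp (rmap m (bid P)) f = bcomp g (rmap (bid N) m).
Proof.
move=> uf ug; apply: bimap_ext2 => y x; rewrite -(nVK y) !bcompE uf.
by rewrite !rmapE !bidE ug bm_lact.
Qed.

End UnitalBimaps.

(** * Naturality and multiplicativity of unital 2-cells *)

Section UnitalNaturality.
Variables (k : fieldType) (X Y : salg k) (P : bimod X X) (N : bimod Y Y).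
Variables (p0 : bimap (regular X) P) (pV : bimap P (regular X)).
Variables (n0 : bimap (regular Y) N) (nV : bimap N (regular Y)).
Hypotheses (p0K : cancel p0 pV) (pVK : cancel pV p0).
Hypotheses (n0K : cancel n0 nV) (nVK : cancel nV n0).
Variables (S : bimod Y X) (f : bimap (rbimod N S) (rbimod S P)).
Hypothesis uf : unital p0 n0 f.

Lemma unital_natP (a : bimap P P) (b : bimap N N) :
  bcomp f (rmap b (bid S)) = bcomp (rmap (bid S) a) f <->
  forall x : S, lact (nV (b (n0 (sone Y)))) x = ract x (pV (a (p0 (sone X)))).
Proof.
set c := nV _; set d := pV _.
have bE y x : bcomp f (rmap b (bid S)) (rt (n0 y) x)
    = rt (lact (smul c y) x) (p0 (sone X)).
  by rewrite bcompE rmapE bidE (endo_unit_smulr nVK) uf.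
have aE y x : bcomp (rmap (bid S) a) f (rt (n0 y) x)
    = rt (ract (lact y x) d) (p0 (sone X)).
  rewrite bcompE uf rmapE bidE (endo_unit_smull pVK) smul1l (unit_lact p0).
  by rewrite rt_balanced.
split=> [e x|e].
- have := bimap_app e (rt (n0 (sone Y)) x).
  rewrite bE aE lact1 smul1r.
  exact: (rt_unit_inj p0K).
(* The hypothesis is used at [lact y x], not at [x]. *)
- apply: bimap_ext2 => y x; rewrite -(nVK y) bE aE lactM.
  by rewrite e.
Qed.

(** On [n0 z], [n0 y], [x] both sides give [rt (lact (smul z y) x) (p0 (sone X))]; on the right [p2]
    merges two copies of [p0 (sone X)] into one. *)
Lemma unital_mult (p2 : bimap (rbimod P P) P) (n2 : bimap (rbimod N N) N) :
  (forall d x, p2 (rt (p0 d) x) = lact d x) ->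
  (forall d x, n2 (rt (n0 d) x) = lact d x) ->
  bcomp f (rmap n2 (bid S))
  = bcomp (rmap (bid S) p2) (bcomp (rassoc S P P) (bcomp (rmap f (bid P))
      (bcomp (rassocV N S P) (bcomp (rmap (bid N) f) (rassoc N N S))))).
Proof.
move=> p2E n2E; apply: bimap_ext3l => z y x; rewrite -(nVK z) -(nVK y).
rewrite [LHS]bcompE [X in bm_fun f X]rmapE n2E bidE -(bm_lact n0) uf.
rewrite 5!bcompE rassocE rmapE bidE uf rassocVE rmapE uf bidE rassocE.
by rewrite rmapE p2E bidE lact1 -lactM.
Qed.

End UnitalNaturality.

(** * Unitality of identities and composites *)

Section UnitalIdComp.
Variables (k : fieldType) (X Y Z : salg k).
Variables (P : bimod X X) (N : bimod Y Y) (M : bimod Z Z).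
Variables (p0 : bimap (regular X) P) (n0 : bimap (regular Y) N).
Variable m0 : bimap (regular Z) M.

Lemma unital_id : unital p0 p0 (bcomp (lunitorV P) (runitor P)).
Proof.
move=> d x; rewrite bcompE runitorE lunitorVE -bm_ract.
by rewrite (unit_lact p0) -rt_balanced /= smul1l.
Qed.

Lemma unital_comp (T : bimod Z Y) (S : bimod Y X)
    (g : bimap (rbimod M T) (rbimod T N)) (f : bimap (rbimod N S) (rbimod S P)) :
  unital n0 m0 g -> unital p0 n0 f ->
  unital p0 m0 (bcomp (rassocV T S P) (bcomp (rmap (bid T) f)
    (bcomp (rassoc T N S) (bcomp (rmap g (bid S)) (rassocV M T S))))).
Proof.
move=> ug uf d; apply: rbimod_ext => [||y x].
- apply: (lin_comp (bimap_lin _)); exact: rt_linr.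
- apply: (lin_comp (rt_linl _)); exact: lact_linr.
- rewrite 4!bcompE rassocVE rmapE ug bidE rassocE rmapE bidE uf lact1 rassocVE.
  by congr rt; rewrite [RHS]rlactE.
Qed.

End UnitalIdComp.
(* Unification of 2-cells of [s2Vect k] with bimodule maps must unfold the
   bicategory before the bimodule operations; otherwise it diverges. *)
Local Strategy 1000
  [rbimod regular bcomp bid rmap rassoc rassocV lunitor lunitorV runitor
   runitorV].

(** * Pseudofunctors on [BBA A] and their central elements *)

Section Scalars.
Variables (k : fieldType) (A : zmodType).
Notation pfun := (pseudofunctor (BBA A) (s2Vect k)).
Implicit Types F G H : pfun.

Definition pf_bimod F : bimod (F tt) (F tt) := pf_1 F (tt : @hom1 (BBA A) tt tt).

Definition pf_unit F : bimap (regular (F tt)) (pf_bimod F) := pf_F0 F tt.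

Definition pf_unitV F : bimap (pf_bimod F) (regular (F tt)) :=
  sval (cid (pf_F0_iso F tt)).

Lemma pf_unitK F : cancel (pf_unit F) (pf_unitV F).
Proof.
move=> x; have [e _] := svalP (cid (pf_F0_iso F tt)).
by have := bimap_app e x; rewrite bcompE bidE.
Qed.

Lemma pf_unitVK F : cancel (pf_unitV F) (pf_unit F).
Proof.
move=> x; have [_ e] := svalP (cid (pf_F0_iso F tt)).
by have := bimap_app e x; rewrite bcompE bidE.
Qed.

Definition pf_act F (a : A) : bimap (pf_bimod F) (pf_bimod F) :=
  @pf_2 _ _ F tt tt tt tt a.

Lemma pf_act0 F : pf_act F 0 = bid (pf_bimod F).
Proof. exact: (pf_id2 F (tt : @hom1 (BBA A) tt tt)). Qed.

Lemma pf_actD F a b : pf_act F (a + b) = bcomp (pf_act F a) (pf_act F b).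
Proof. exact: (@pf_vcomp _ _ F tt tt tt tt tt a b). Qed.

(** The element c_F(a) of the overview. *)
Definition pf_scal F (a : A) : F tt :=
  pf_unitV F (pf_act F a (pf_unit F (sone (F tt)))).

Lemma pf_scalC F a d : smul (pf_scal F a) d = smul d (pf_scal F a).
Proof.
apply: (can_inj (pf_unitK (F := F))).
rewrite -(endo_unit_smull (pf_unitVK (F := F))).
by rewrite (endo_unit_smulr (pf_unitVK (F := F))).
Qed.

Definition pf_comp F : bimap (rbimod (pf_bimod F) (pf_bimod F)) (pf_bimod F) :=
  pf_F2 F (tt : @hom1 (BBA A) tt tt) tt.

(** Left unit coherence: the left unitor of [BBA A] is [0], which [F] sends to the identity, so the
    unitor determines the compositor. *)
Lemma pf_comp_unit F (d : F tt) (m : pf_bimod F) :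
  pf_comp F (rt (pf_unit F d) m) = lact d m.
Proof.
have := bimap_app (pf_lunit F (tt : @hom1 (BBA A) tt tt))
  (rt (d : regular (F tt)) m).
rewrite lunitorE => ->.
by rewrite 2!bcompE (pf_id2 F (tt : @hom1 (BBA A) tt tt)) bidE rmapE bidE.
Qed.

Section Transformations.
Variables F G : pfun.
Implicit Types s t : transformation F G.

Definition tr_bimod s : bimod (G tt) (F tt) := s tt.

Definition tr_bimap s :
    bimap (rbimod (pf_bimod G) (tr_bimod s)) (rbimod (tr_bimod s) (pf_bimod F)) :=
  tr_2 s (tt : @hom1 (BBA A) tt tt).

Definition tr_unital s := unital (pf_unit F) (pf_unit G) (tr_bimap s).

Definition intertwines (S : bimod (G tt) (F tt)) :=
  forall a (x : S), lact (pf_scal G a) x = ract x (pf_scal F a).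

Lemma strong_unital s : strong s -> tr_unital s.
Proof. by case=> _ _ us _; apply/unitalP; exact: us tt. Qed.

Lemma strong_intertwines s : strong s -> intertwines (tr_bimod s).
Proof.
move=> ss a; have us := strong_unital ss; case: ss => _ nat _ _.
exact: ((unital_natP (pf_unitK (F := F)) (pf_unitVK (F := F))
  (pf_unitVK (F := G)) us (pf_act F a) (pf_act G a)).1 (nat tt tt tt tt a)).
Qed.

Lemma unital_strong s : tr_unital s -> intertwines (tr_bimod s) -> strong s.
Proof.
move=> us iS; split.
- move=> [] [] [].
  exact: (unital_bij (pf_unitK (F := F)) (pf_unitVK (F := F))
    (pf_unitVK (F := G)) us).
- move=> [] [] [] [] a.
  exact: ((unital_natP (pf_unitK (F := F)) (pf_unitVK (F := F))
    (pf_unitVK (F := G)) us (pf_act F a) (pf_act G a)).2 (iS a)).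
- by case; exact: ((unitalP _ _ _).2 us).
- move=> [] [] [] [] [].
  exact: (unital_mult (pf_unitVK (F := G)) us
    (pf_comp_unit (F := F)) (pf_comp_unit (F := G))).
Qed.

(** The modification axiom is automatic by [unital_modif], so an isomorphism of carriers
    suffices. *)
Lemma unital_iso s t (m : @hom2 (s2Vect k) _ _ (s tt) (t tt)) :
  tr_unital s -> tr_unital t -> iso2 m -> iso_transformation s t.
Proof.
move=> us ut im.
exists (unit_rect (fun a => @hom2 (s2Vect k) _ _ (s a) (t a)) m).
split; last by case.
move=> [] [] []; exact: (unital_modif (pf_unitVK (F := G)) m us ut).
Qed.

(** [unit_rect] makes the carrier at [tt] reduce to [S]. *)
Definition mk_tr (S : bimod (G tt) (F tt)) : transformation F G.
Proof.
refine (@Transformation _ _ F G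
  (unit_rect (fun a => @hom1 (s2Vect k) (F a) (G a)) S) _).
move=> [] [] []; exact: (unital_map (pf_unit F) (pf_unitV G) S).
Defined.

Lemma mk_tr_unital S : tr_unital (mk_tr S).
Proof. exact: (unital_mapP _ (pf_unitK (F := G))). Qed.

End Transformations.

Lemma tr_id_unital F : tr_unital (tr_id F).
Proof. exact: (unital_id (pf_unit F)). Qed.

Lemma tr_comp_unital F G H (t : transformation G H) (s : transformation F G) :
  tr_unital t -> tr_unital s -> tr_unital (tr_comp t s).
Proof. exact: unital_comp. Qed.

Lemma equivalence_mk_tr F G (S : bimod (G tt) (F tt)) (T : bimod (F tt) (G tt))
    (x : @hom2 (s2Vect k) _ _ (rbimod T S) (regular (F tt)))
    (y : @hom2 (s2Vect k) _ _ (rbimod S T) (regular (G tt))) :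
  intertwines S -> intertwines T -> iso2 x -> iso2 y -> equivalence (mk_tr S).
Proof.
move=> iS iT ix iy.
have uS := @mk_tr_unital F G S; have uT := @mk_tr_unital G F T.
split; first exact: unital_strong.
exists (mk_tr T); split; first exact: unital_strong.
- exact: (unital_iso (tr_comp_unital uT uS) (@tr_id_unital F) ix).
- exact: (unital_iso (tr_comp_unital uS uT) (@tr_id_unital G) iy).
Qed.

(** With [equivalence_mk_tr], this expresses equivalence by conditions that see [F] only through
    [F tt] and [pf_scal F]. *)
Lemma internally_equivalentP F G :
  internally_equivalent F G ->
  exists (S : bimod (G tt) (F tt)) (T : bimod (F tt) (G tt))
      (x : @hom2 (s2Vect k) _ _ (rbimod T S) (regular (F tt)))
      (y : @hom2 (s2Vect k) _ _ (rbimod S T) (regular (G tt))),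
    [/\ intertwines S, intertwines T, iso2 x & iso2 y].
Proof.
case=> s [ss [t [st [m [_ im]] [n [_ jn]]]]].
exists (s tt), (t tt), (m tt), (n tt).
by split; [exact: strong_intertwines ss|exact: strong_intertwines st| |].
Qed.

End Scalars.

(** * The normal form, its existence and uniqueness *)

Section Normal.
Variables (R : realType) (k : fieldType) (s : smooth_field R k).
Variable A : abLieGroup R.

Lemma pf_scal_normal (D : salg k) (b : smooth_aut s A D) a :
  pf_scal (normal_rep b) a = b a (sone D).
Proof.
have F0n x : pf_unit (normal_rep b) x = x by exact: bidE.
(* [pf_unitV] is a chosen inverse and does not compute; putting the identity [pf_unit] in front lets
   it cancel. *)
by rewrite /pf_scal F0n -[LHS]F0n pf_unitVK.
Qed.

(** A left linear endomorphism of [regular D] is determined by its value at [sone D]. *)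
Lemma smooth_aut_eq (D : salg k) (b c : smooth_aut s A D) :
  (forall a, b a (sone D) = c a (sone D)) -> b = c.
Proof.
move=> e; have {}e : aut_fun b = aut_fun c.
  apply: funext => a; apply: bimap_eq => d.
  rewrite -(smul1r d) -[smul d _]/(lact d (sone D : regular D)).
  by rewrite !bm_lact e.
case: b c e => [f f0 fD fs] [g g0 gD gs] /= e; case: _ / e g0 gD gs => g0 gD gs.
by rewrite (Prop_irrelevance f0 g0) (Prop_irrelevance fD gD)
  (Prop_irrelevance fs gs).
Qed.

Variable F : two_rep s A.

Definition conj_act (a : A) : bimap (regular (F tt)) (regular (F tt)) :=
  bcomp (pf_unitV F) (bcomp (pf_act F a) (pf_unit F)).

Lemma conj_act0 : conj_act 0 = bid _.
Proof.
by apply: bimap_eq => d; rewrite !bcompE pf_act0 !bidE pf_unitK.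
Qed.

Lemma conj_actD a b : conj_act (a + b) = bcomp (conj_act a) (conj_act b).
Proof.
by apply: bimap_eq => d; rewrite !bcompE pf_unitVK pf_actD bcompE.
Qed.

(** Conjugation by the unitor is linear, so a linear form [phi] pulls back to a linear form on
    endomorphisms of [pf_bimod F], where smoothness of [F] applies. *)
Lemma conj_act_smooth : smooth_vect s (fun a => bm_fun (conj_act a)).
Proof.
move=> phi.
pose h (f : 'Hom(pf_bimod F, pf_bimod F)) : 'End(regular (F tt)) :=
  (bm_fun (pf_unitV F) \o (f \o bm_fun (pf_unit F)))%VF.
have hl : linear h.
  by move=> c f g; apply/lfunP => x; rewrite !lfun_simp linearP.
pose psi f := phi (h f).
have psil : scalar psi by move=> c f g; rewrite /psi hl linearP.
pose m := GRing.isLinear.Build k _ _ *%R psi psil.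
pose P : {scalar 'Hom(pf_bimod F, pf_bimod F)} := HB.pack psi m.
exact: (rep_smooth P).
Qed.

Definition normal_form : smooth_aut s A (F tt) :=
  SmoothAut conj_act0 conj_actD conj_act_smooth.

Lemma pf_scal_normal_form a : pf_scal (normal_rep normal_form) a = pf_scal F a.
Proof.
by rewrite pf_scal_normal -[normal_form a]/(conj_act a) /conj_act 2!bcompE.
Qed.

(** The regular bimodule is its own inverse through the left unitor; on it, intertwining is
    centrality of [pf_scal F a]. *)
Lemma normal_form_equivalent : equivalent_over_id normal_form.
Proof.
exists (@mk_tr _ _ F (normal_rep normal_form) (regular (F tt))); split=> //.
have ix := iso2_lunit (id1 (F tt : s2Vect k)).
apply: (@equivalence_mk_tr _ _ F (normal_rep normal_form) (regular (F tt))
  (regular (F tt)) _ _ _ _ ix ix) => a z.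
- by rewrite pf_scal_normal_form; exact: pf_scalC.
- by rewrite pf_scal_normal_form; exact: pf_scalC.
Qed.

End Normal.

Theorem lemma7p1 (R : realType) (k : fieldType)
    (char0 : ([pchar k] =i pred0)%R) (s : smooth_field R k)
    (A : abLieGroup R)
    (A_compact : compact [set: A]%classic) (A_fg : finitely_generated A)
    (F : two_rep s A) :
  exists beta : smooth_aut s A (F tt),
    [/\ internally_equivalent F (normal_rep beta),
        forall beta' : smooth_aut s A (F tt),
          internally_equivalent F (normal_rep beta') ->
          internally_equivalent (normal_rep beta) (normal_rep beta')
      & unique (fun b : smooth_aut s A (F tt) => equivalent_over_id b) beta].
Proof.
exists (normal_form F); have [t [et t1]] := normal_form_equivalent F; split.
- by exists t.
- move=> b /internally_equivalentP[S [T [x [y [iS iT ix iy]]]]].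
  (* [S] and [T] serve again, since [F] and its normal form share algebra and scalars. *)
  exists (@mk_tr _ _ (normal_rep (normal_form F)) (normal_rep b) S).
  apply: (@equivalence_mk_tr _ _ (normal_rep (normal_form F)) (normal_rep b)
    S T _ _ _ _ ix iy) => a z.
  + by rewrite pf_scal_normal_form iS.
  + by rewrite pf_scal_normal_form iT.
split; first by exists t.
move=> b [t' [[st' _] t1']]; apply: smooth_aut_eq => a.
rewrite -!pf_scal_normal pf_scal_normal_form.
(* On the regular bimodule, intertwining at [sone] equates the two scalars. *)
have := strong_intertwines st'; rewrite /tr_bimod t1' => /(_ a (sone _)) /=.
by rewrite smul1l smul1r.
Qed.
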